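(* Let $G$ be an acyclic ADT network with a source $S$ and destinations $\mathcal T=\{T_1,\dots,T_K\}$. Let $\mathcal C=\{(S,T_i,\mathcal X(S,T_i)) : i=1,\dots,K\}$ be a disjoint multicast, i.e. $\mathcal X(S,T_i)\cap\mathcal X(S,T_j)=\emptyset$ for all $i\neq j$. Then $(G,\mathcal C)$ is solvable if and only if $\mathrm{mincut}(S,\mathcal T')\ge\sum_{T_i\in\mathcal T'}|\mathcal X(S,T_i)|$ for every subset $\mathcal T'\subseteq\mathcal T$.
   Context: ADT network model. $G=(\mathcal V,\mathcal E)$ is a directed acyclic network of supernodes, each with input ports $I(V)$ and output ports $O(V)$. Edges go from output ports to input ports of other supernodes. Linear coding over a finite field $\mathbb F_q$: - An output port $e\in O(V)$ carries $Y(e)=\sum_{e'\in I(V)}\beta_{(e',e)}Y(e')$. At $S$, the term $\sum_k\alpha_{(k,e)}X(S,k)$ is added, where $\mathcal X(S)$ are the independent source processes. - An output port sends the same symbol on all of its outgoing edges. - An input port $e'$ receives $Y(e')=\sum_{(e,e')\in\mathcal E}Y(e)$, the sum taken over $\mathbb F_q$. - A destination $T$ outputs $Z(T,k)=\sum_{e'\in I(T)}\epsilon_{(e',(T,k))}Y(e')$. A connection $(S,T_i,\mathcal X(S,T_i))$ with $\mathcal X(S,T_i)\subseteq\mathcal X(S)$ is established if $T_i$'s outputs equal $\mathcal X(S,T_i)$. $(G,\mathcal C)$ is solvable if a single coefficient choice establishes all connections. Following the paper's convention, the field size $q$ may be chosen as large as needed. For $\mathcal T'\subseteq\mathcal T$,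 $\mathrm{mincut}(S,\mathcal T')=\min_\Omega\mathrm{rank}(G_\Omega)$, with the minimum over partitions $\Omega\cup\Omega^c$ of the supernodes with $S\in\Omega$ and $\mathcal T'\subseteq\Omega^c$. $G_\Omega$ is the $0$-$1$ incidence matrix of the edges from output ports of supernodes in $\Omega$ to input ports of supernodes in $\Omega^c$. *)

(* Defs.v *)
From HB Require Import structures.
From mathcomp Require Import all_boot all_order all_algebra all_field.
Set Implicit Arguments. Unset Strict Implicit. Unset Printing Implicit Defensive.
Import GRing.Theory.

(* ADT network model.
   - V : supernodes;  P : ports;  own p : the supernode owning port p;
   - isin p : p is an input port (otherwise an output port);
   - E p p' : there is an edge from (output) port p to (input) port p'. *)

Definition wf_network (V P : finType) (own : P -> V) (isin : pred P) (E : rel P)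
  : Prop :=
  forall p p', E p p' -> [/\ ~~ isin p, isin p' & own p != own p'].

Definition sadj (V P : finType) (own : P -> V) (E : rel P) : rel V :=
  fun u v => [exists p, exists p', [&& E p p', own p == u & own p' == v]].

Definition acyclic (V P : finType) (own : P -> V) (E : rel P) : Prop :=
  forall u v, sadj own E u v -> ~~ connect (sadj own E) v u.

Local Open Scope ring_scope.

(* symbols are represented by their (global) coefficient vectors w.r.t. the
   source processes X(S,0), ..., X(S,r-1) *)
Definition unit_vec (F : fieldType) (r : nat) (k : 'I_r) : 'rV[F]_r :=
  \row_j (j == k)%:R.

Definition coding_consistent (F : fieldType) (V P : finType) (own : P -> V)
  (isin : pred P) (E : rel P) (S : V) (r : nat)
  (alpha : 'I_r -> P -> F) (beta : P -> P -> F) (Y : P -> 'rV[F]_r) : Prop :=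
  (forall e, ~~ isin e ->
     Y e = \sum_(e' | isin e' && (own e' == own e)) beta e' e *: Y e'
           + (if own e == S then \sum_(k < r) alpha k e *: unit_vec F k else 0))
  /\ (forall e', isin e' -> Y e' = \sum_(e | E e e') Y e).

Definition dest_output (F : fieldType) (V P : finType) (own : P -> V)
  (isin : pred P) (r : nat) (T : V) (eps_k : P -> F) (Y : P -> 'rV[F]_r)
  : 'rV[F]_r :=
  \sum_(e' | isin e' && (own e' == T)) eps_k e' *: Y e'.

Definition solvable (V P : finType) (own : P -> V) (isin : pred P) (E : rel P)
  (S : V) (r K : nat) (T : 'I_K -> V) (X : 'I_K -> {set 'I_r}) : Prop :=
  exists F : finFieldType,
  exists (alpha : 'I_r -> P -> F) (beta : P -> P -> F)
         (eps : 'I_K -> 'I_r -> P -> F) (Y : P -> 'rV[F]_r),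
    coding_consistent own isin E S alpha beta Y /\
    forall i k, k \in X i -> dest_output own isin (T i) (eps i k) Y = unit_vec F k.

(* G_Omega : 0-1 incidence matrix of the edges from output ports of supernodes
   in Omega to input ports of supernodes in Omega^c (rows/cols indexed by all
   ports; the extra zero rows/columns do not affect the rank). *)
Definition cut_matrix (V P : finType) (own : P -> V) (isin : pred P) (E : rel P)
  (Om : {set V}) : 'M[rat]_(#|P|, #|P|) :=
  \matrix_(a, b)
    (if [&& ~~ isin (enum_val a), own (enum_val a) \in Om,
            isin (enum_val b), own (enum_val b) \notin Om
          & E (enum_val a) (enum_val b)] then 1 else 0).

(* mincut(S, T') = min over Omega with S in Omega, T' in Omega^c of rank G_Omega
   (the default #|P| bounds every rank, so it never affects a nonempty min) *)
Definition mincut (V P : finType) (own : P -> V) (isin : pred P) (E : rel P)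
  (S : V) (Tp : {set V}) : nat :=
  \big[minn/#|P|]_(Om : {set V} | (S \in Om) && (Tp \subset ~: Om))
     \rank (cut_matrix own isin E Om).

(* Main.v *)
(** Necessity: across a cut Omega, every symbol seen in the complement of Omega
    is a linear combination, through the incidence matrix of the cut, of the
    symbols emitted by Omega; so the number of decoded processes is at most the
    rank of that 0-1 matrix over F, which never exceeds its rank over Q.

    Sufficiency is a counting argument over F_p, for a prime p > 2^|V| preserving
    the rational ranks of all cuts.  Process k is to be output at a node t k (its
    destination, or S itself if nobody wants it).  Fix a message w <> 0 and count
    the pairs (code, port symbols) in which all r outputs vanish, according to the
    set Omega of nodes with a nonzero input.  Given the port symbols, each output
    port of Omega and each k with t k in Omega puts one nontrivial linear condition
    on its own coefficients; and the symbols emitted by Omega lie in the kernel of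
    the cut matrix.  Hence at most N p^-(rank + #{k | t k in Omega}) <= N p^-r
    pairs, N being the number of codes, and fewer than 2^|V| N triples
    (message, code, port symbols) overall.  A code with singular transfer matrix
    accounts for at least p - 1 >= 2^|V| triples, the multiples of one kernel
    message, so some code has an invertible transfer matrix; precoding at S by its
    inverse delivers every process. *)
Require Import Defs.
From HB Require Import structures.
From mathcomp Require Import all_boot all_order all_algebra all_field.
From mathcomp Require Import mxabelem zify.
Set Implicit Arguments. Unset Strict Implicit. Unset Printing Implicit Defensive.
Import Order.TTheory GRing.Theory Num.Theory.

Local Open Scope ring_scope.

(** * Ranks of integer matrices over different fields *)

Lemma mxrank_mxsub (F : fieldType) m n p q (f : 'I_p -> 'I_m) (g : 'I_q -> 'I_n)
  (A : 'M[F]_(m, n)) : (\rank (mxsub f g A) <= \rank A)%N.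
Proof.
rewrite mxsubrc; apply: leq_trans (mxrankS (rowsub_sub _ _)) _.
rewrite -mxrank_tr trmx_mxsub -(mxrank_tr A).
exact: mxrankS (rowsub_sub _ _).
Qed.

Lemma unit_minor (F : fieldType) m n (A : 'M[F]_(m, n)) :
  exists (f : 'I_(\rank A) -> 'I_m) (g : 'I_(\rank A) -> 'I_n),
    mxsub f g A \in unitmx.
Proof.
pose f := maxrankfun A; have full : row_full (rowsub f A)^T.
  by rewrite /row_full mxrank_tr; apply: maxrowsub_free.
exists f, (fullrankfun full).
rewrite -unitmx_tr; apply: etrans (fullrowsub_unit full).
by congr (_ \in unitmx); apply/matrixP => i j; rewrite !mxE.
Qed.

(** The certificate [z] is an integer minor of maximal size not vanishing in [F]; it survives in
    every field where its image is nonzero. *)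
Lemma intmx_rank_transfer (F : fieldType) m n (A : 'M[int]_(m, n)) :
  exists2 z : int, z%:~R != 0 :> F &
    forall K : fieldType, z%:~R != 0 :> K ->
      (\rank (map_mx intr A : 'M[F]_(m, n)) <=
       \rank (map_mx intr A : 'M[K]_(m, n)))%N.
Proof.
have [f [g]] := unit_minor (map_mx intr A : 'M[F]_(m, n)).
rewrite unitmxE -map_mxsub det_map_mx unitfE => nz.
exists (\det (mxsub f g A)) => // K nzK.
suff <- : \rank (mxsub f g (map_mx intr A : 'M[K]_(m, n)))
  = \rank (map_mx intr A : 'M[F]_(m, n)) by apply: mxrank_mxsub.
by apply: mxrank_unit; rewrite unitmxE -map_mxsub det_map_mx unitfE.
Qed.

Lemma intr_Fp_neq0 (p : nat) (z : int) : prime p -> z != 0 -> (`|z| < p)%N ->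
  z%:~R != 0 :> 'F_p.
Proof.
move=> pr_p z0 zp; have nz : `|z|%:R != 0 :> 'F_p.
  rewrite -(dvdn_pcharf (pchar_Fp pr_p)); apply/negP => /dvdn_leq.
  by rewrite absz_gt0 z0 leqNgt zp => /(_ isT).
by rewrite [z]intEsign rmorphM /= rmorph_sign mulf_neq0 ?signr_eq0.
Qed.

Lemma rank_rat_Fp (I : finType) m n (A : I -> 'M[int]_(m, n)) (N : nat) :
  exists2 p, prime p & (N < p)%N /\ forall i,
    (\rank (map_mx intr (A i) : 'M[rat]_(m, n)) <=
     \rank (map_mx intr (A i) : 'M['F_p]_(m, n)))%N.
Proof.
have /fin_all_exists2 [z nz rk] i := intmx_rank_transfer rat (A i).
(* A prime exceeding the absolute values of all the certifying minors divides none of them. *)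
have [p] := prime_above (maxn N (\max_i `|z i|%N)).
rewrite gtn_max => /andP[Np zp] pr_p; exists p => //; split=> // i.
apply: rk; apply: intr_Fp_neq0 => //.
  by have := nz i; rewrite intr_eq0.
by apply: leq_ltn_trans zp; apply: (leq_bigmax_cond (F := fun i => `|z i|%N)).
Qed.

Lemma intmx_rank_le_rat (F : fieldType) m n (A : 'M[int]_(m, n)) :
  (\rank (map_mx intr A : 'M[F]_(m, n)) <=
   \rank (map_mx intr A : 'M[rat]_(m, n)))%N.
Proof.
have [z nz] := intmx_rank_transfer F A; apply.
by rewrite intr_eq0; apply: contraNneq nz => ->.
Qed.

(** * Counting solutions of linear equations over a finite field *)

(** If [u j0] is nonzero, shifting coordinate [j0] of a solution by [a] changes the form by
    [a * u j0]. So the shift is recoverable from the result, and solutions times shifts inject into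
    all vectors. *)
Lemma card_hyperplane (F : finFieldType) (J : finType) (u : J -> F) (b : F) :
  (#|[set c : {ffun J -> F} | (\sum_j c j * u j == b)%R]|
     * #|F| ^ [exists j, u j != 0%R] <= #|{: {ffun J -> F}}|)%N.
Proof.
case: existsP => [[j0 nz]|_]; last by rewrite muln1 max_card.
rewrite expn1 -[#|F|]cardsT -cardsX.
pose f (x : {ffun J -> F} * F) := [ffun j => x.1 j + x.2 *+ (j == j0)].
have fE c a : \sum_j f (c, a) j * u j = \sum_j c j * u j + a * u j0.
  rewrite (eq_bigr (fun j => c j * u j + a *+ (j == j0) * u j)); last first.
    by move=> j _; rewrite ffunE mulrDl.
  rewrite big_split /=; congr (_ + _).
  by rewrite (bigD1 j0) //= eqxx big1 ?addr0 // => j /negPf->; rewrite mul0r.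
apply: (@leq_card_in _ _ f) => -[c a] [d e].
rewrite !inE /= !andbT => /eqP hc /eqP hd eq_f.
have eq_a : a = e.
  apply: (mulIf nz); apply: (addrI b).
  by rewrite -{1}hc -hd -!fE eq_f.
congr (_, _) => //; apply/ffunP => j.
by move/ffunP/(_ j): eq_f; rewrite !ffunE /= eq_a => /addIr.
Qed.

Lemma card_family_prod (aT rT : finType) (D : aT -> pred rT) :
  #|family D| = (\prod_x #|D x|)%N.
Proof. by rewrite card_family foldrE big_map big_enum. Qed.

Lemma card_hyperplanes (F : finFieldType) (Q J : finType) (act : pred Q)
  (u : Q -> J -> F) (b : Q -> F) :
  (#|[set c : {ffun Q -> {ffun J -> F}} |
        [forall s, act s ==> (\sum_j c s j * u s j == b s)%R]]|
     * #|F| ^ #|[set s | act s && [exists j, u s j != 0%R]]|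
   <= #|{: {ffun Q -> {ffun J -> F}}}|)%N.
Proof.
pose D s := [pred c : {ffun J -> F} | act s ==> (\sum_j c j * u s j == b s)].
have -> : #|[set c : {ffun Q -> {ffun J -> F}} | [forall s, D s (c s)]]| =
          #|family D|.
  by rewrite cardsE; apply: eq_card => c; apply: eq_forallb.
rewrite card_family_prod -sum1_card expn_sum.
rewrite [X in (_ * X)%N](_ : _ =
    \prod_s #|F| ^ (act s && [exists j, u s j != 0%R]))%N; last first.
  rewrite big_mkcond; apply: eq_bigr => s _; rewrite inE.
  by case: (act s && _).
rewrite -big_split /= card_ffun -prod_nat_const.
apply: leq_prod => s _; rewrite /D; case: (act s) => /=.
  by have := card_hyperplane (u s) (b s); rewrite cardsE.
by rewrite muln1 max_card.
Qed.

(** Rows of [G] outside [A] vanish, so a solution supported on [A] can be completed by arbitrary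
    entries off [A] and stays in the left kernel of [G]. *)
Lemma card_kernel_supported (F : finFieldType) (P : finType) (A : {set P}) m
  (G : 'M[F]_(#|P|, m)) :
  (forall a b, enum_val a \notin A -> G a b = 0) ->
  (#|[set z : {ffun P -> F} | [forall p, (p \notin A) ==> (z p == 0%R)]
        && ((\row_a z (enum_val a)) *m G == 0)%R]| * #|F| ^ (#|P| - #|A|)
   <= #|F| ^ (#|P| - \rank G))%N.
Proof.
move=> G0; rewrite -mxrank_ker -card_rowg.
have -> : (#|P| - #|A| = #|~: A|)%N by rewrite -(cardsC A) addKn.
rewrite -(card_pffun_on 0 (mem (~: A)) predT).
rewrite -[#|pffun_on _ _ _|]cardsE -cardsX.
pose f (x : {ffun P -> F} * {ffun P -> F}) : 'rV[F]_#|P| :=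
  \row_a (x.1 (enum_val a) + x.2 (enum_val a)).
rewrite -(@card_in_imset _ _ f).
  apply/subset_leq_card/subsetP => _ /imsetP[[z g] zg ->]; rewrite mem_rowg.
  move: zg; rewrite !inE /= => /andP[/andP[_ /eqP zG] /pffun_onP[g0 _]].
  apply/sub_kermxP.
  rewrite (_ : f _ = \row_a z (enum_val a) + \row_a g (enum_val a)).
    rewrite mulmxDl zG add0r; apply/rowP => b; rewrite !mxE big1 // => a _.
    rewrite mxE; have [aA|/G0->] := boolP (enum_val a \in A); last by rewrite mulr0.
    have -> : g (enum_val a) = 0; last by rewrite mul0r.
    by apply/eqP; apply: contraTT aA => /(subsetP g0); rewrite inE.
  by apply/rowP => a; rewrite !mxE.
move=> [z g] [z' g'].
rewrite !inE /= => /andP[/andP[/forallP z0 _] /pffun_onP[g0 _]].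
move=> /andP[/andP[/forallP z0' _] /pffun_onP[g0' _]] /rowP fE.
have sumE p : z p + g p = z' p + g' p.
  by have := fE (enum_rank p); rewrite !mxE enum_rankK.
have gA (h : {ffun P -> F}) p : support h \subset mem (~: A) -> p \in A -> h p = 0.
  by move=> sh pA; apply/eqP; apply: contraTT pA => /(subsetP sh); rewrite inE.
have zz' : z = z'.
  apply/ffunP => p; have [pA|pA] := boolP (p \in A).
    by have := sumE p; rewrite (gA g) // (gA g') // !addr0.
  by rewrite (eqP (implyP (z0 p) pA)) (eqP (implyP (z0' p) pA)).
congr (_, _) => //; apply/ffunP => p.
by have := sumE p; rewrite zz' => /addrI.
Qed.

(** * Codes of a network *)

Section Network.

Variables (V P : finType) (own : P -> V) (isin : pred P) (E : rel P).

(** A general ring lets one integer matrix specialize both to [rat] and to a finite field. *)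
Definition cutmx (R : nzRingType) (Om : {set V}) : 'M[R]_(#|P|, #|P|) :=
  \matrix_(a, b)
    ([&& ~~ isin (enum_val a), own (enum_val a) \in Om,
         isin (enum_val b), own (enum_val b) \notin Om
       & E (enum_val a) (enum_val b)])%:R.

Lemma cut_matrixE Om : cut_matrix own isin E Om = cutmx rat Om.
Proof. by apply/matrixP => a b; rewrite !mxE; case: ifP. Qed.

Lemma map_cutmx (R : nzRingType) Om : map_mx intr (cutmx int Om) = cutmx R Om.
Proof. by apply/matrixP => a b; rewrite !mxE rmorph_nat. Qed.

Hypothesis wf : wf_network own isin E.

Variables (S : V) (r : nat).

(** * Counting silenced codes by the set of nodes that hear something *)

Section Count.

Variables (F : finFieldType) (t : 'I_r -> V).

(* All that node [v] can combine; a code stores, for each output port [inl e] and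
   each process output [inr k], one coefficient per coordinate of this vector. *)
Definition node_input (w : 'I_r -> F) (y : P -> F) (v : V) (s : P + 'I_r) : F :=
  match s with
  | inl e => if isin e && (own e == v) then y e else 0
  | inr k => if v == S then w k else 0
  end.

Definition site (s : P + 'I_r) : V :=
  match s with inl e => own e | inr k => t k end.

Definition emits (s : P + 'I_r) : bool :=
  if s is inl e then ~~ isin e else true.

Definition emitted (y : P -> F) (s : P + 'I_r) : F :=
  if s is inl e then y e else 0.

Local Notation code := {ffun P + 'I_r -> {ffun P + 'I_r -> F}}.

Lemma sum_node_input (c : P + 'I_r -> F) w y v :
  \sum_s c s * node_input w y v s =
  \sum_(e | isin e && (own e == v)) c (inl e) * y e
  + (if v == S then \sum_k c (inr k) * w k else 0).
Proof.
rewrite big_sumType /=; congr (_ + _).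
  by rewrite [RHS]big_mkcond; apply: eq_bigr => e _; case: ifP; rewrite ?mulr0.
by case: ifP => // _; rewrite big1 // => k _; rewrite mulr0.
Qed.

(* Code [c], message [w] and port symbols [y] agree, and all outputs are zero. *)
Definition silenced (w : 'I_r -> F) (y : P -> F) (c : code) : bool :=
  [forall s, emits s ==>
     (\sum_j c s j * node_input w y (site s) j == emitted y s)].

Definition received (y : P -> F) : bool :=
  [forall e', isin e' ==> (y e' == \sum_(e | E e e') y e)].

Definition heard (w : 'I_r -> F) (y : P -> F) : {set V} :=
  [set v | [exists s, node_input w y v s != 0]].

Variables (Om : {set V}) (w : 'I_r -> F).

Let A := [set p | ~~ isin p & own p \in Om].
(** Requiring some code forces the output ports of unheard nodes to vanish; symbols without a code
    contribute nothing to the count. *)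
Let Y := [set y : {ffun P -> F} |
            [&& received y, heard w y == Om & [exists c, silenced w y c]]].

Lemma unheard_port y p : y \in Y -> own p \notin Om -> y p = 0.
Proof.
rewrite inE => /and3P[_ /eqP <- /existsP[c /forallP cy]] pOm.
have in0 s : node_input w y (own p) s = 0.
  by apply/eqP; apply: contraNT pOm => nz; rewrite inE; apply/existsP; exists s.
have [pin|pout] := boolP (isin p).
  by have := in0 (inl p); rewrite /= pin eqxx.
have /implyP/(_ pout)/eqP /= <- := cy (inl p).
by rewrite big1 // => s _; rewrite in0 mulr0.
Qed.

(** Symbols in [Y] are determined by their values on [A]: other output ports carry zero, and input
    ports carry sums of output ports. Input ports outside [Om] carry zero too, which puts the
    restriction to [A] in the kernel of the cut matrix. *)
Lemma card_received_le :
  (#|Y| * #|F| ^ (#|P| - #|A|) <= #|F| ^ (#|P| - \rank (cutmx F Om)))%N.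
Proof.
have G0 a b : enum_val a \notin A -> cutmx F Om a b = 0.
  rewrite inE mxE => /negPf aA.
  by case: (~~ isin _) (own _ \in _) aA => [] [].
apply: leq_trans (card_kernel_supported G0); rewrite leq_mul2r; apply/orP; right.
pose f (y : {ffun P -> F}) := [ffun p => if p \in A then y p else 0].
have yE y p : y \in Y -> isin p -> y p = \sum_(e | E e p) y e.
  by rewrite inE => /andP[/forallP/(_ p)/implyP + _] pin => /(_ pin)/eqP.
rewrite -(@card_in_imset _ _ f).
  apply/subset_leq_card/subsetP => _ /imsetP[y yY ->]; rewrite inE.
  apply/andP; split.
    by apply/forallP => p; apply/implyP => /negPf pA; rewrite ffunE pA.
  apply/eqP/rowP => b; rewrite !mxE.
  have [/andP[bin bOm]|bOm] :=
    boolP (isin (enum_val b) && (own (enum_val b) \notin Om)).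
    rewrite -[RHS](unheard_port yY bOm) yE //.
    rewrite [RHS](reindex_onto (@enum_val P predT) enum_rank) /=; last first.
      by move=> p _; apply: enum_rankK.
    rewrite [RHS]big_mkcond /=; apply: eq_bigr => a _.
    rewrite !mxE ffunE enum_valK eqxx andbT bin bOm inE /=.
    have [Eab|] := boolP (E _ _); last by rewrite !andbF mulr0.
    have [-> _ _] := wf Eab => /=; case: ifP => [_|/negbT/(unheard_port yY)->].
      by rewrite mulr1.
    by rewrite mul0r.
  rewrite big1 // => a _; rewrite !mxE; case: and5P => [[_ _ bi bO _]|].
    by rewrite bi bO in bOm.
  by rewrite mulr0.
move=> y y' yY y'Y /ffunP eq_f.
have eq_out p : ~~ isin p -> y p = y' p.
  move=> pout; have [pOm|pOm] := boolP (own p \in Om).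
    by have := eq_f p; rewrite !ffunE inE pout pOm.
  by rewrite !unheard_port.
apply/ffunP => p; have [pin|/eq_out//] := boolP (isin p).
by rewrite !yE //; apply: eq_bigr => e /wf[/eq_out].
Qed.

(** With [y] fixed, distinct sites constrain disjoint families of coefficients, and a constraint is
    nontrivial exactly when the node of its site lies in [Om]. *)
Lemma card_silenced_le (y : {ffun P -> F}) : heard w y == Om ->
  (#|[set c | silenced w y c]| * #|F| ^ (#|A| + #|[set k | t k \in Om]|)
   <= #|{: code}|)%N.
Proof.
move=> /eqP yOm.
apply: leq_trans (card_hyperplanes emits (fun s => node_input w y (site s))
                    (emitted y)).
rewrite leq_mul2l leq_pexp2l ?orbT //; first by apply/card_gt0P; exists 0.
rewrite -!sum1_card big_sumType /= leq_add //; apply/eq_leq/eq_bigl.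
  by move=> p; rewrite !inE -yOm inE.
by move=> k; rewrite !inE -yOm inE.
Qed.

Lemma card_heard_le : (#|[set k | t k \notin Om]| <= \rank (cutmx F Om))%N ->
  ((\sum_(y : {ffun P -> F} | received y && (heard w y == Om))
      #|[set c | silenced w y c]|) * #|F| ^ r <= #|{: code}|)%N.
Proof.
move=> rk; set q := #|F|; set N := #|{: code}|; set sigma := (\sum_(y | _) _)%N.
have q0 n : (0 < q ^ n)%N by rewrite expn_gt0; apply/orP; left; apply/card_gt0P; exists 0.
set tin := #|[set k | t k \in Om]|.
have le_sigma : (sigma * q ^ (#|A| + tin) <= #|Y| * N)%N.
  rewrite -sum_nat_const big_distrl /= [leqRHS]big_mkcond /= [leqLHS]big_mkcond /=.
  apply: leq_sum => y _; case: ifP => // /andP[ry hy].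
  rewrite inE ry hy /=; case: ifP => [_|/existsPn none].
    exact: card_silenced_le.
  by rewrite (_ : [set c | _] = set0) ?cards0 //; apply/setP => c; rewrite !inE (negPf (none c)).
have le_r : (r <= tin + \rank (cutmx F Om))%N.
  rewrite -{1}[r]card_ord -(cardsC [set k | t k \in Om]) leq_add2l.
  by apply: leq_trans rk; apply/subset_leq_card/subsetP => k; rewrite !inE.
have rkP := rank_leq_row (cutmx F Om).
have AP : (#|A| <= #|P|)%N := max_card _.
(* Scaling by [q ^ #|P|] allows the two bounds to be multiplied without division; the factors in
   [#|A|] then cancel. *)
rewrite -(leq_pmul2r (q0 #|P|)).
have := leq_mul (leq_mul le_sigma (leqnn (q ^ (#|P| - #|A|)))) (leqnn (q ^ \rank (cutmx F Om))).
rewrite [leqRHS](_ : _ = (#|Y| * q ^ (#|P| - #|A|)) * (N * q ^ \rank (cutmx F Om)))%N; last by lia.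
move=> /leq_trans/(_ (leq_mul card_received_le (leqnn _))).
rewrite mulnCA -expnD subnK //; apply: leq_trans.
rewrite -!mulnA leq_mul2l -!expnD leq_pexp2l ?orbT //; first exact: (q0 1%N).
by lia.
Qed.

End Count.

(** * Double counting yields an invertible transfer matrix *)

Section Invertible.

Variables (F : finFieldType) (t : 'I_r -> V).

Local Notation code := {ffun P + 'I_r -> {ffun P + 'I_r -> F}}.

Hypothesis cut_t : forall Om : {set V}, S \in Om ->
  (#|[set k | t k \notin Om]| <= \rank (cutmx F Om))%N.

Lemma card_silenced_message (w : 'I_r -> F) : [exists k, w k != 0] ->
  ((\sum_(y : {ffun P -> F} | received y) #|[set c | silenced t w y c]|)
     * #|F| ^ r <= 2 ^ #|V| * #|{: code}|)%N.
Proof.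
move=> /existsP[k wk].
rewrite (partition_big (fun y : {ffun P -> F} => heard w y) predT) //=.
have <- : #|{set V}| = (2 ^ #|V|)%N.
  rewrite -[#|V|]cardsT -card_powerset.
  by apply: eq_card => Om; rewrite !inE subsetT.
rewrite -sum_nat_const big_distrl /=.
apply: leq_sum => Om _; have [SOm|SOm] := boolP (S \in Om).
  exact: card_heard_le (cut_t SOm).
(* A nonzero message is heard at [S], so sets missing [S] contribute nothing. *)
rewrite big_pred0 // => y; apply/negP => /andP[_ /eqP yOm].
rewrite -yOm inE in SOm; case/existsP: SOm.
by exists (inr k); rewrite /= eqxx.
Qed.

Definition consistent (c : code) (Y : P -> 'rV[F]_r) : Prop :=
  coding_consistent own isin E S (fun k e => c (inl e) (inr k))
    (fun e' e => c (inl e) (inl e')) Y.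

Definition output_row (c : code) (Y : P -> 'rV[F]_r) (k : 'I_r) : 'rV[F]_r :=
  \sum_(e | isin e && (own e == t k)) c (inr k) (inl e) *: Y e
  + (if t k == S then \sum_j c (inr k) (inr j) *: unit_vec F j else 0).

Definition transfer_mx c Y : 'M[F]_r := \matrix_k output_row c Y k.

(** Pairing the global coefficient vectors [Y p] with [v] runs the code on message [v]; linearity
    allows the factor [a], and the kernel condition makes all outputs zero. *)
Lemma silenced_of_kernel c Y (v : 'rV[F]_r) a :
  consistent c Y -> v *m (transfer_mx c Y)^T = 0 ->
  received (fun p => a * (Y p *m v^T) 0 0)
  && silenced t (fun k => a * v 0 k) (fun p => a * (Y p *m v^T) 0 0) c.
Proof.
move=> [Yout Yin] ker; set y := (fun p => _).
have unitE k : (unit_vec F k *m v^T) 0 0 = v 0 k.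
  rewrite mxE (bigD1 k) //= !mxE eqxx mul1r big1 ?addr0 // => j /negPf jk.
  by rewrite mxE jk mul0r.
have inputE (d : P + 'I_r -> F) u :
    \sum_j d j * node_input (fun k => a * v 0 k) y u j =
    a * ((\sum_(e | isin e && (own e == u)) d (inl e) *: Y e
     + (if u == S then \sum_j d (inr j) *: unit_vec F j else 0)) *m v^T) 0 0.
  rewrite sum_node_input mulmxDl mxE mulrDr; congr (_ + _).
    rewrite mulmx_suml summxE mulr_sumr; apply: eq_bigr => e _.
    by rewrite -scalemxAl mxE mulrCA.
  case: ifP => _; last by rewrite mul0mx mxE mulr0.
  rewrite mulmx_suml summxE mulr_sumr; apply: eq_bigr => k _.
  by rewrite -scalemxAl mxE unitE mulrCA.
apply/andP; split.
  apply/forallP => e; apply/implyP => ein; rewrite /y Yin //.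
  rewrite mulmx_suml summxE mulr_sumr; exact/eqP/eq_bigr.
apply/forallP => s; apply/implyP; rewrite inputE; case: s => [e|k] /= eout.
  by rewrite -Yout.
move/matrixP/(_ 0 k): ker; rewrite -[v in v *m _]trmxK -trmx_mul mxE.
rewrite [in RHS]mxE => ker; rewrite -/(output_row c Y k).
rewrite (_ : (output_row c Y k *m v^T) 0 0 = 0) ?mulr0 // -[RHS]ker !mxE.
by apply: eq_bigr => j _; rewrite !mxE.
Qed.

Lemma card_silenced_singular c Y : consistent c Y ->
  transfer_mx c Y \notin unitmx ->
  (#|F|.-1 <= #|[set wy : {ffun 'I_r -> F} * {ffun P -> F} |
      [&& [exists k, wy.1 k != 0%R], received wy.2
        & silenced t wy.1 wy.2 c]]|)%N.
Proof.
move=> cY; rewrite -unitmx_tr -row_free_unit -kermx_eq0 => /rowV0Pn[v].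
move=> /sub_kermxP ker v0; have /rV0Pn[k vk] := v0.
pose f a : {ffun 'I_r -> F} * {ffun P -> F} :=
  ([ffun k => a * v 0 k], [ffun p => a * (Y p *m v^T) 0 0]).
have <- : #|[set~ (0 : F)]| = #|F|.-1 by rewrite cardsC1.
rewrite -(@card_in_imset _ _ f); last first.
  move=> a b _ _ [/ffunP/(_ k) + _]; rewrite !ffunE; exact: mulIf.
apply/subset_leq_card/subsetP => _ /imsetP[a + ->]; rewrite !inE => a0.
have /andP[rec sil] := silenced_of_kernel a cY ker.
have fE1 : (f a).1 =1 (fun k => a * v 0 k) by move=> j; rewrite ffunE.
have fE2 : (f a).2 =1 (fun p => a * (Y p *m v^T) 0 0) by move=> p; rewrite ffunE.
apply/and3P; split; first by apply/existsP; exists k; rewrite fE1 mulf_neq0.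
  apply/forallP => e; have /forallP/(_ e) := rec; rewrite fE2.
  by congr (_ ==> (_ == _)); apply: eq_bigr => e' _; rewrite fE2.
apply/forallP => s; have /forallP/(_ s) := sil.
congr (_ ==> (_ == _)).
  by apply: eq_bigr => -[e|j] _; rewrite /= ?fE1 ?fE2.
by case: s => //= e; rewrite fE2.
Qed.

Lemma exists_invertible_transfer : (2 ^ #|V| < #|F|)%N ->
  (forall c, exists Y, consistent c Y) ->
  exists c Y, consistent c Y /\ transfer_mx c Y \in unitmx.
Proof.
move=> ltF /fin_all_exists[Y cY].
have [/existsP[c Mc]|/existsPn sing] :=
  boolP [exists c, transfer_mx c (Y c) \in unitmx]; first by exists c, (Y c).
pose B c := [set wy : {ffun 'I_r -> F} * {ffun P -> F} |
   [&& [exists k, wy.1 k != 0], received wy.2 & silenced t wy.1 wy.2 c]].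
pose W := [set w : {ffun 'I_r -> F} | [exists k, w k != 0]].
have q0 : (0 < #|F|)%N by apply: leq_ltn_trans ltF.
have leB : (#|{: code}| * #|F|.-1 <= \sum_c #|B c|)%N.
  rewrite -sum_nat_const; apply: leq_sum => c _.
  exact: card_silenced_singular (cY c) (sing c).
have eqB : (\sum_c #|B c| = \sum_(w in W) \sum_(y : {ffun P -> F} | received y)
    #|[set c | silenced t w y c]|)%N.
  rewrite pair_big /=.
  rewrite (eq_bigr (fun c : code => \sum_(wy : {ffun 'I_r -> F} * {ffun P -> F} |
     (wy.1 \in W) && received wy.2) (silenced t wy.1 wy.2 c : nat))%N); last first.
    move=> c _; rewrite -sum1_card big_mkcond [RHS]big_mkcond /=.
    apply: eq_bigr => wy _; rewrite !inE.
    by case: [exists _, _]; case: (received _); case: (silenced _ _ _).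
  rewrite exchange_big /=; apply: eq_bigr => wy _.
  rewrite -sum1_card [RHS]big_mkcond /=; apply: eq_bigr => c _.
  by rewrite inE; case: (silenced _ _ _).
(* Excluding the zero message gives the strict inequality needed against [#|F|.-1], which may equal
   [2 ^ #|V|]. *)
have ltW : (#|W| < #|F| ^ r)%N.
  have <- : #|{: {ffun 'I_r -> F}}| = (#|F| ^ r)%N by rewrite card_ffun card_ord.
  rewrite -cardsT.
  apply: proper_card; apply/properP; split; first exact: subsetT.
  exists [ffun=> 0]; rewrite ?inE //; apply/existsPn => k.
  by rewrite ffunE eqxx.
have leW : ((\sum_c #|B c|) * #|F| ^ r <= #|W| * (2 ^ #|V| * #|{: code}|))%N.
  rewrite eqB big_distrl -sum_nat_const /=; apply: leq_sum => w.
  by rewrite inE; apply: card_silenced_message.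
have N0 : (0 < #|{: code}|)%N by apply/card_gt0P; exists 0.
have V0 : (0 < 2 ^ #|V|)%N by rewrite expn_gt0.
have : ((\sum_c #|B c|) * #|F| ^ r < (#|{: code}| * #|F|.-1) * #|F| ^ r)%N.
  apply: leq_ltn_trans leW _; rewrite mulnC.
  apply: (@leq_trans (2 ^ #|V| * #|{: code}| * #|F| ^ r)).
    by rewrite ltn_pmul2l // muln_gt0 V0.
  rewrite leq_mul2r; apply/orP; right; rewrite mulnC leq_mul2l; apply/orP; right.
  by rewrite -ltnS prednK.
by rewrite ltn_mul2r => /andP[_]; rewrite ltnNge leB.
Qed.

End Invertible.

(** * Induction along the acyclic network: existence of symbols and the cut bound *)

Section Acyclic.

Hypothesis ac : acyclic own E.

(** Doubling the number of ancestors leaves room to place the outputs of a node strictly between its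
    inputs and the inputs of its successors. *)
Definition height (p : P) : nat :=
  (#|[set u | connect (sadj own E) u (own p)]|.*2 + ~~ isin p)%N.

Lemma height_edge p p' : E p p' -> (height p < height p')%N.
Proof.
move=> Epp'; rewrite /height; have [-> -> _] := wf Epp'; rewrite addn1 addn0 ltn_Sdouble.
have adj : sadj own E (own p) (own p').
  by apply/existsP; exists p; apply/existsP; exists p'; rewrite Epp' !eqxx.
apply: proper_card; apply/properP; split.
  by apply/subsetP => u; rewrite !inE => /connect_trans; apply; apply: connect1.
by exists (own p'); rewrite inE ?connect0 //; apply: ac.
Qed.

Lemma height_node p p' : own p = own p' -> isin p -> ~~ isin p' ->
  (height p < height p')%N.
Proof. by rewrite /height => -> -> ->; rewrite addn0 addn1. Qed.

Lemma consistent_exists (F : finFieldType)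
  (c : {ffun P + 'I_r -> {ffun P + 'I_r -> F}}) :
  exists Y, consistent c Y.
Proof.
pose step (Y : P -> 'rV[F]_r) p :=
  if isin p then \sum_(e | E e p) Y e else
  \sum_(e' | isin e' && (own e' == own p)) c (inl p) (inl e') *: Y e'
  + (if own p == S then \sum_(k < r) c (inl p) (inr k) *: unit_vec F k else 0).
have stepE Y Y' p : (forall e, (height e < height p)%N -> Y e = Y' e) ->
    step Y p = step Y' p.
  move=> eqY; rewrite /step; case: ifPn => ip.
    by apply: eq_bigr => e /height_edge/eqY.
  congr (_ + _); apply: eq_bigr => e /andP[ie /eqP ee].
  by rewrite eqY // height_node.
(* Each round of [step] settles one more level of height, so iterating beyond the largest height
   reaches a fixed point. *)
have stable n p : (height p < n)%N -> iter n.+1 step (fun=> 0) p = iter n step (fun=> 0) p.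
  elim: n p => // n IHn p; rewrite ltnS => hp.
  by apply: stepE => e he; apply: IHn; apply: leq_trans hp.
pose n := (\max_p height p).+1; exists (iter n step (fun=> 0)).
have fix_ p : iter n step (fun=> 0) p = step (iter n step (fun=> 0)) p.
  by rewrite -[LHS]stable // ltnS; apply: (leq_bigmax_cond (F := height)).
by split=> p ip; rewrite [LHS]fix_ /step ?ip // (negPf ip).
Qed.

Lemma card_decoded_le (F : fieldType) alpha beta (Y : P -> 'rV[F]_r)
  (Om : {set V}) (D : {set 'I_r}) :
  coding_consistent own isin E S alpha beta Y -> S \in Om ->
  (forall k, k \in D -> exists (v : V) (eps : P -> F), v \notin Om /\
     dest_output own isin v eps Y = unit_vec F k) ->
  (#|D| <= \rank (cutmx F Om))%N.
Proof.
move=> [Yout Yin] SOm dec.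
(* The row of [W] at an input port outside [Om] is the part of its symbol arriving from [Om]; the
   other rows vanish. *)
pose W := (cutmx F Om)^T *m (\matrix_a Y (enum_val a)).
have W_port p : own p \notin Om -> (Y p <= W)%MS.
  have [n hp] := ubnP (height p); elim: n p hp => // n IHn p hp pOm.
  have [pin|pout] := boolP (isin p); last first.
    rewrite Yout //; case: eqP => [pS|_]; first by rewrite pS SOm in pOm.
    rewrite addr0; apply: summx_sub => e /andP[ein /eqP ep].
    apply/scalemx_sub/IHn; last by rewrite ep.
    by apply: leq_trans (height_node ep ein pout) _.
  (* Contributions from [Om] form a row of [W]; the others come from lower ports outside [Om],
     covered by induction. *)
  rewrite Yin // (bigID (fun e => own e \in Om)) /=; apply: addmx_sub; last first.
    apply: summx_sub => e /andP[/height_edge Eep eOm]; apply: IHn => //.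
    exact: leq_trans Eep _.
  suff -> : \sum_(e | E e p && (own e \in Om)) Y e = row (enum_rank p) W.
    exact: row_sub.
  apply/rowP => j; rewrite !mxE summxE [LHS](reindex_onto (@enum_val P predT) enum_rank).
    rewrite big_mkcond /=; apply: eq_bigr => a _.
    rewrite !mxE enum_rankK enum_valK eqxx andbT pin pOm /=.
    have [Eap|] := boolP (E _ _); last by rewrite !andbF mul0r.
    have [-> _ _] := wf Eap; case: (own _ \in _); first by rewrite mul1r.
    by rewrite mul0r.
  by move=> e _; rewrite enum_rankK.
pose U : 'M[F]_(#|D|, r) := \matrix_i unit_vec F (enum_val i).
have <- : \rank U = #|D|.
  apply/eqP/row_freeP; exists U^T; apply/matrixP => i j; rewrite !mxE.
  rewrite (bigD1 (enum_val i)) //= !mxE eqxx mul1r big1 ?addr0 => [|k /negPf ki].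
    by rewrite (inj_eq enum_val_inj).
  by rewrite !mxE ki mul0r.
rewrite -(mxrank_tr (cutmx F Om)); apply: leq_trans (mxrankM_maxl _ (\matrix_a Y (enum_val a))).
apply: mxrankS; apply/row_subP => i; rewrite rowK.
have [v [eps [vOm <-]]] := dec _ (enum_valP i).
apply: summx_sub => e /andP[_ /eqP ev]; apply/scalemx_sub/W_port.
by rewrite ev.
Qed.

End Acyclic.

End Network.

(** * The two directions of the equivalence *)

Lemma unit_vec_sum (F : fieldType) r (v : 'rV[F]_r) :
  v = \sum_k v 0 k *: unit_vec F k.
Proof.
rewrite [LHS]row_sum_delta; apply: eq_bigr => k _; congr (_ *: _).
by apply/rowP => j; rewrite !mxE eqxx.
Qed.

Lemma card_disjoint_bigcup (I J : finType) (X : I -> {set J}) (A : {set I}) :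
  (forall i j, i != j -> [disjoint X i & X j]) ->
  (\sum_(i in A) #|X i| = #|\bigcup_(i in A) X i|)%N.
Proof.
move=> dis; pose G i := if i \in A then X i else set0.
rewrite [in RHS]big_mkcond -[RHS]sum1_card (@partition_disjoint_bigcup _ _ _ _ _ G).
  rewrite big_mkcond; apply: eq_bigr => i _; rewrite sum1_card /G.
  by case: ifP; rewrite ?cards0.
move=> i j ij; rewrite /G; case: ifP => _; last by rewrite -setI_eq0 set0I.
by case: ifP => _; [apply: dis | rewrite -setI_eq0 setI0].
Qed.

Section Solvable.

Variables (V P : finType) (own : P -> V) (isin : pred P) (E : rel P).
Variables (S : V) (r K : nat) (T : 'I_K -> V) (X : 'I_K -> {set 'I_r}).

Hypotheses (wf : wf_network own isin E) (ac : acyclic own E).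
Hypotheses (TS : forall i, T i != S).
Hypothesis dis : forall i j, i != j -> [disjoint X i & X j].

Lemma solvable_rank_cut (Tp : {set 'I_K}) (Om : {set V}) :
  solvable own isin E S T X -> S \in Om -> [set T i | i in Tp] \subset ~: Om ->
  (\sum_(i in Tp) #|X i| <= \rank (cut_matrix own isin E Om))%N.
Proof.
move=> [F [alpha [beta [eps [Y [con dec]]]]]] SOm /subsetP TOm.
rewrite (card_disjoint_bigcup _ dis) cut_matrixE -map_cutmx.
apply: leq_trans (intmx_rank_le_rat F _); rewrite map_cutmx.
apply: (card_decoded_le wf ac con SOm) => k /bigcupP[i iTp kX].
exists (T i), (eps i k); split; last exact: dec.
by have := TOm (T i) (imset_f _ iTp); rewrite inE.
Qed.

Lemma rank_cut_solvable :
  (forall (Tp : {set 'I_K}) (Om : {set V}), S \in Om ->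
     [set T i | i in Tp] \subset ~: Om ->
     (\sum_(i in Tp) #|X i| <= \rank (cut_matrix own isin E Om))%N) ->
  solvable own isin E S T X.
Proof.
move=> cut; pose t k := if [pick i | k \in X i] is Some i then T i else S.
have tE i k : k \in X i -> t k = T i.
  rewrite /t => kX; case: pickP => [j kXj|/(_ i)]; last by rewrite kX.
  have [-> //|/dis] := eqVneq j i.
  by rewrite -setI_eq0 => /eqP/setP/(_ k); rewrite !inE kXj kX.
have [p pr_p [ltp rkp]] := rank_rat_Fp (cutmx own isin E int) (2 ^ #|V|).
have cut_t (Om : {set V}) : S \in Om ->
    (#|[set k | t k \notin Om]| <= \rank (cutmx own isin E 'F_p Om))%N.
  move=> SOm; rewrite -map_cutmx; apply: leq_trans (rkp Om).
  (* The hypothesis is applied to all destinations beyond the cut. Processes nobody wants sit at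
     [S], inside [Om], and are not counted. *)
  rewrite map_cutmx -cut_matrixE; pose Tp := [set i | T i \notin Om].
  apply: leq_trans (cut Tp Om SOm _).
    rewrite (card_disjoint_bigcup _ dis); apply/subset_leq_card/subsetP => k.
    rewrite inE /t; case: pickP => [i kX TOm|]; last by rewrite SOm.
    by apply/bigcupP; exists i; rewrite ?inE.
  by apply/subsetP => _ /imsetP[i iTp ->]; rewrite inE in iTp; rewrite inE.
have [||c [Y [[Yout Yin] unitM]]] := exists_invertible_transfer wf cut_t.
- by rewrite card_Fp.
- exact: consistent_exists.
pose M := transfer_mx own isin S t c Y; pose N := invmx M.
(* Precoding changes only [alpha]: every symbol is multiplied on the right by [N], while [beta] and
   [eps] are read off [c]. *)
exists 'F_p, (fun k e => ((\sum_j c (inl e) (inr j) *: unit_vec _ j) *m N) 0 k),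
  (fun e' e => c (inl e) (inl e')), (fun _ k e' => c (inr k) (inl e')),
  (fun p => Y p *m N).
split; [split=> [e eout|e ein]|move=> i k kX].
- rewrite Yout // mulmxDl; congr (_ + _).
    by rewrite mulmx_suml; apply: eq_bigr => e' _; rewrite scalemxAl.
  by case: ifP => _; rewrite ?mul0mx // -unit_vec_sum.
- by rewrite Yin // mulmx_suml.
have outE : output_row own isin S t c Y k =
    \sum_(e | isin e && (own e == T i)) c (inr k) (inl e) *: Y e.
  by rewrite /output_row (tE i) // (negPf (TS i)) addr0.
transitivity (row k (M *m N)).
  rewrite row_mul rowK outE mulmx_suml.
  by apply: eq_bigr => e _; rewrite scalemxAl.
by rewrite mulmxV //; apply/rowP => j; rewrite !mxE eq_sym.
Qed.

End Solvable.

Local Close Scope ring_scope.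

Theorem theorem6 (V P : finType) (own : P -> V) (isin : pred P) (E : rel P)
  (S : V) (r K : nat) (T : 'I_K -> V) (X : 'I_K -> {set 'I_r}) :
  wf_network own isin E ->
  acyclic own E ->
  injective T ->
  (forall i, T i != S) ->
  (forall i j, i != j -> [disjoint X i & X j]) ->
  solvable own isin E S T X <->
  (forall Tp : {set 'I_K},
     (\sum_(i in Tp) #|X i| <= mincut own isin E S [set T i | i in Tp])%N).
Proof.
move=> wf ac _ TS dis; split=> [sol Tp|cut].
  have le_rk (Om : {set V}) : (S \in Om) && ([set T i | i in Tp] \subset ~: Om) ->
      (\sum_(i in Tp) #|X i| <= \rank (cut_matrix own isin E Om))%N.
    by case/andP; apply: solvable_rank_cut.
  apply: (big_ind (fun m => \sum_(i in Tp) #|X i| <= m)%N) => //.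
    (* The default [#|P|] of the minimum must also dominate the sum; the cut [[set S]] is admissible
       because no destination is [S], and its rank is at most [#|P|]. *)
    apply: leq_trans (le_rk [set S] _) (rank_leq_row _).
    rewrite set11; apply/subsetP => _ /imsetP[i _ ->].
    by rewrite !inE TS.
  by move=> m n; rewrite leq_min => -> ->.
apply: rank_cut_solvable => // Tp Om SOm TOm.
apply: leq_trans (cut Tp) _.
rewrite /mincut -minEnat -leEnat; apply: bigmin_le_cond.
by rewrite SOm.
Qed.
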